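(* Let $X$ and $Y$ be compact metric spaces and let $F:X\to 2^X$ and $G:Y\to 2^Y$ be upper semi-continuous. If $G$ is topologically semi-conjugate to $F$, then $h(G)\le h(F)$.
   Context: $\mathbb{N}=\{1,2,\ldots\}$. For a compact metric space $X$ with metric $d$, $2^X$ is the set of non-empty compact subsets of $X$. $F:X\to 2^X$ is upper semi-continuous if for every $x\in X$ and every open $V\subseteq X$ containing $F(x)$ there is an open $U\ni x$ with $F(t)\subseteq V$ for all $t\in U$. Semi-conjugacy: $G$ is topologically semi-conjugate to $F$ if there exists a continuous surjection $\varphi:X\to Y$ such that for all $x\in X$, $G(\varphi(x))\subseteq\varphi(F(x))$, where $\varphi(F(x))=\{\varphi(y):y\in F(x)\}$. Entropy: for $n\in\mathbb{N}$, $\mathrm{Orb}_n(X,F)$ is the set of $n$-orbits, i.e. finite sequences $(x_0,\ldots,x_{n-1})$ in $X$ with $x_{i+1}\in F(x_i)$ for $0\le i\le n-2$, with the metric $D(\mathbf{x},\mathbf{y})=\max_{0\le i\le n-1}d(x_i,y_i)$. A subset of a metric space is $\epsilon$-separated if any two of its distinct points are at distance $\ge\epsilon$. $s_{n,\epsilon}(F)$ is the largest cardinality of an $\epsilon$-separated subset of $(\mathrm{Orb}_n(X,F),D)$, and the topological entropy of $F$ is $h(F)=\lim_{\epsilon\to0}\limsup_{n\to\infty}\frac1n\log s_{n,\epsilon}(F)\in[0,\infty]$. The entropy $h(G)$ is defined in the same way. *)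

(* Defs.v *)
From mathcomp Require Import all_boot all_order all_algebra.
From mathcomp Require Import finmap.
From mathcomp Require Import all_classical all_reals all_analysis.

Set Implicit Arguments.
Unset Strict Implicit.
Unset Printing Implicit Defensive.

Import Order.TTheory GRing.Theory Num.Theory.
Import numFieldNormedType.Exports.

Local Open Scope classical_set_scope.
Local Open Scope ring_scope.

(* The hyperspace 2^X. *)
Definition hyperspace (X : topologicalType) : set (set X) :=
  [set A | A !=set0 /\ compact A].

Definition upper_semicontinuous (X Y : topologicalType) (F : X -> set Y) :=
  forall (x : X) (V : set Y), open V -> F x `<=` V ->
    exists U : set X, [/\ open U, U x & forall t, U t -> F t `<=` V].

(* [semi_conjugate G F]: G is topologically semi-conjugate to F. *)
Definition semi_conjugate (X Y : topologicalType)
    (G : Y -> set Y) (F : X -> set X) :=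
  exists phi : X -> Y,
    [/\ continuous phi, set_surj [set: X] [set: Y] phi &
        forall x, G (phi x) `<=` phi @` F x].

Definition orbits (X : Type) (F : X -> set X) (n : nat) : set (n.-tuple X) :=
  [set x | forall i j : 'I_n, j = i.+1 :> nat -> F (tnth x i) (tnth x j)].
Arguments orbits {X} F n.

(* Distances being nonnegative, 0 is a neutral start value for the maximum. *)
Definition tuple_dist (R : realType) (X : metricType R) (n : nat)
    (x y : n.-tuple X) : R :=
  \big[Num.max/0]_(i < n) mdist (tnth x i) (tnth y i).

Definition eps_separated (R : realType) (T : Type) (D : T -> T -> R) (eps : R)
    (A : set T) :=
  forall x y, A x -> A y -> x <> y -> eps <= D x y.

Section entropy.
Context (R : realType) (X : metricType R).
Local Open Scope ereal_scope.

(* The supremum is a maximum as soon as X is compact and eps > 0, see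
   [max_separated_attained]. *)
Definition max_separated (F : X -> set X) (n : nat) (eps : R) : \bar R :=
  ereal_sup [set k%:R%:E | k in [set k : nat | exists A : set (n.-tuple X),
    [/\ A `<=` orbits F n, eps_separated (@tuple_dist R X n) eps A
      & (A #= `I_k)%card]]].

Definition growth (F : X -> set X) (eps : R) : \bar R :=
  limn_esup (fun n => (n%:R^-1)%:E * lne (max_separated F n eps)).

(* The limit exists for every F, see [is_cvg_growth]. *)
Definition entropy (F : X -> set X) : \bar R :=
  lim (growth F eps @[eps --> 0%R^'+]).

Lemma max_separated_ge0 F n eps : 0 <= max_separated F n eps.
Proof.
apply: ereal_sup_ubound; exists 0%N => //=; exists set0; split => //.
by rewrite II0.
Qed.

Lemma max_separated_nonincreasing F n (e1 e2 : R) : (e1 <= e2)%R ->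
  max_separated F n e2 <= max_separated F n e1.
Proof.
move=> e12; apply: ge_ereal_sup => _ [k [A [AF sA Ak]] <-].
apply: ereal_sup_ubound; exists k => //=; exists A; split => //.
by move=> x y Ax Ay xy; apply: le_trans (sA _ _ Ax Ay xy).
Qed.

Lemma growth_nonincreasing F (e1 e2 : R) : (e1 <= e2)%R ->
  growth F e2 <= growth F e1.
Proof.
move=> e12; rewrite /growth /limn_esup !limf_esupE.
apply: le_ereal_inf_tmp => _ [V VF <-].
apply: ge_ereal_inf; eexists; first by exists V; [exact: VF|reflexivity].
apply: ge_ereal_sup => _ [n Vn <-].
apply: le_trans; last by apply: ereal_sup_ubound; exists n; [exact: Vn|reflexivity].
apply: lee_wpmul2l; first by rewrite lee_fin invr_ge0.
rewrite lee_lne ?in_itv/= ?andbT ?leey ?max_separated_ge0//.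
exact: max_separated_nonincreasing.
Qed.

Lemma is_cvg_growth F : cvg (growth F eps @[eps --> 0%R^'+]).
Proof.
apply: nonincreasing_at_right_is_cvge; near=> e => x y _ _ xy.
exact: growth_nonincreasing.
Unshelve. all: by end_near. Qed.

Lemma max_separated_attained F n (eps : R) :
  compact [set: X] -> (0 < eps)%R ->
  exists (k : nat) (A : set (n.-tuple X)),
    [/\ A `<=` orbits F n, eps_separated (@tuple_dist R X n) eps A,
        (A #= `I_k)%card & max_separated F n eps = k%:R%:E].
Proof.
move=> cX e0.
have [D hD] : exists D : {fset X}, forall x, exists c : D,
    ball (fsval c) (eps / 2) x.
  pose FF : set_system {fset X} := [set B | exists A0 : {fset X},
    forall A : {fset X}, (A0 `<=` A)%fset -> B A].
  have FFF : Filter FF.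
    split; first by exists fset0.
    - move=> P Q [A hA] [B hB]; exists (A `|` B)%fset => C.
      by rewrite fsubUset => /andP[/hA ? /hB ?].
    - by move=> P Q PQ [A hA]; exists A => C /hA /PQ.
  move/compact_near_coveringP : cX => /(_ _ FF
    (fun A x => exists c : A, ball (fsval c) (eps / 2) x) FFF)[].
    move=> x _; exists (ball x (eps / 2), [set A | x \in A]) => /=.
      split; first by apply: nbhsx_ballx; rewrite divr_gt0.
      by exists [fset x]%fset => A; rewrite fsub1set.
    by move=> [y A] /= [xy xA]; exists [` xA]%fset.
  by move=> D hD; exists D => x; exact: (hD D (fsubset_refl D) x I).
pose c x := sval (cid (hD x)).
have cP x : ball (fsval (c x)) (eps / 2) x by rewrite /c; case: cid.
pose g (x : n.-tuple X) : nat := enum_rank (map_tuple c x).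
pose N := #|{: n.-tuple D}|.
pose P k := `[< exists A : set (n.-tuple X),
  [/\ A `<=` orbits F n, eps_separated (@tuple_dist R X n) eps A
    & (A #= `I_k)%card] >].
have exP : exists k, P k.
  by exists 0%N; apply/asboolP; exists set0; split => //; rewrite II0.
have leP k : P k -> (k <= N)%N.
  move/asboolP => [A [_ sA Ak]].
  rewrite -card_le_II -(card_le_eql Ak).
  have gA : (g @` A #= A)%card.
    apply: inj_card_eq => x y /[!inE] Ax Ay gxy; apply: contrapT => xy.
    have := sA x y Ax Ay xy; apply/negP; rewrite -ltNge.
    have /enum_rank_inj gE := val_inj gxy.
    apply: bigmax_lt => // i _.
    have cE : c (tnth x i) = c (tnth y i).
      by have := congr1 (fun t : n.-tuple D => tnth t i) gE; rewrite !tnth_map.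
    have : ball (tnth x i) eps (tnth y i).
      apply: (@ball_splitr _ _ (fsval (c (tnth x i)))); first exact: cP.
      by rewrite cE; exact: cP.
    by rewrite ballEmdist.
  rewrite -(card_le_eql gA); apply: subset_card_le => _ [x _ <-] /=.
  exact: ltn_ord.
case: (ex_maxnP exP leP) => k /asboolP[A [AF sA Ak]] kmax.
exists k, A; split => //; apply/eqP; rewrite eq_le; apply/andP; split.
  apply: ge_ereal_sup => _ [m /asboolP Pm <-].
  by rewrite lee_fin ler_nat; exact: kmax.
by apply: ereal_sup_ubound; exists k => //; exists A.
Qed.

End entropy.

(* Main.v *)
Require Import Defs.
From mathcomp Require Import all_boot all_order all_algebra.
From mathcomp Require Import all_classical all_reals all_analysis.

(** Entropy cannot increase along a semi-conjugacy [phi] because every orbit of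
    [G] is the image under [phi] of an orbit of [F] ([orbit_lift]): start from
    any preimage of the first point; the inclusion
    [G (phi x) `<=` phi @` F x] then says that each step of the [G]-orbit is
    the image of a step of [F] from the preimage already chosen.  Hence
    an [eps]-separated set of [n]-orbits of [G] lifts injectively to a set of
    [n]-orbits of [F].

    The lifted set is still separated, at a scale that does not depend on [n]:
    [phi] is uniformly continuous by compactness of [X]
    ([compact_unif_continuous]), and if points at distance less than [delta]
    have images at distance less than [eps], then two lifts at distance less
    than [delta] would come from orbits at distance less than [eps].  So
    [max_separated G n eps <= max_separated F n delta] for all [n], and the
    growth rate of [G] at scale [eps] is at most that of [F] at scale [delta],
    which never exceeds the entropy of [F] since growth rates increase as the
    scale shrinks ([growth_le_entropy]). *)

Set Implicit Arguments.
Unset Strict Implicit.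
Unset Printing Implicit Defensive.

Import Order.TTheory GRing.Theory Num.Theory.
Import numFieldNormedType.Exports.

Local Open Scope classical_set_scope.
Local Open Scope ring_scope.

(** The Heine-Cantor theorem.  Near a point [x] where [f] varies by less than
    [e / 2] on a ball of radius [r], any scale below [r / 2] is good enough;
    compactness lets one choose a common scale. *)
Lemma compact_unif_continuous (R : realType) (X Y : pseudoMetricType R)
    (f : X -> Y) :
  compact [set: X] -> continuous f -> unif_continuous f.
Proof.
move=> cX cf; apply/unif_continuousP => e e0.
have e20 : 0 < e / 2 by rewrite divr_gt0.
pose good (d : R) x := forall z, ball x d z -> ball (f x) e (f z).
move/compact_near_coveringP : cX => /(_ _ (0 : R)^'+ good _)[].
  move=> x _.
  have /nbhs_ballP[r /= r0 fr] :
      nbhs x (f @^-1` ball (f x) (e / 2)) by apply/cf/nbhsx_ballx.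
  have r20 : 0 < r / 2 by rewrite divr_gt0.
  exists (ball x (r / 2), [set d | d < r / 2]) => /=.
    by split; [exact: nbhsx_ballx|exact: nbhs_right_lt].
  move=> [x' d] /= [xx' dr] z x'z; apply: (@ball_splitr _ _ (f x)).
    by apply: fr; apply: le_ball xx'; rewrite ler_pdivrMr// ler_peMr ?ler1n ?ltW.
  by apply: fr; apply: (ball_split xx'); apply: le_ball x'z; exact: ltW.
(* [dgood] covers the scales strictly below [d] only, hence [d / 2]. *)
move=> d /= d0 dgood; exists (d / 2); first by rewrite divr_gt0.
move=> [x z] /= xz; apply: (dgood (d / 2)) => //=; last by rewrite divr_gt0.
by rewrite sub0r normrN gtr0_norm ?divr_gt0// ltr_pdivrMr// ltr_pMr// ltr1n.
Qed.

(** The section [l] is defined on all tuples, not only on the orbits of [G]: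
    when the step of [F] being looked for does not exist, any preimage of the
    next point is taken.  As a result [l] is injective everywhere. *)
Lemma orbit_lift (X Y : choiceType) (F : X -> set X) (G : Y -> set Y)
    (phi : X -> Y) (n : nat) :
  set_surj [set: X] [set: Y] phi ->
  (forall x, G (phi x) `<=` phi @` F x) ->
  exists2 l : n.-tuple Y -> n.-tuple X, cancel l (map_tuple phi) &
    forall y, orbits G n y -> orbits F n (l y).
Proof.
move=> sphi GF; case: n => [|n].
  by exists (fun=> [tuple]) => [y|y _ []//]; rewrite tuple0 [RHS]tuple0.
have /choice[g gK] : forall y, exists x, phi x = y.
  by move=> y; have [x _ <-] := sphi y I; exists x.
pose next x y := xget (g y) (F x `&` phi @^-1` [set y]).
have phi_next x y : phi (next x y) = y.
  by rewrite /next; case: xgetP => [_ -> []|_].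
have F_next x y : G (phi x) y -> F x (next x y).
  by case/GF => x' Fx' phix'; have [|] := @xgetPex _ (g y)
    (F x `&` phi @^-1` [set y]); first by exists x'.
pose u (y : n.+1.-tuple Y) := fix u i :=
  if i is j.+1 then next (u j) (nth (thead y) y i) else g (thead y).
have phi_u y i : phi (u y i) = nth (thead y) y i.
  by case: i => [|i] /=; rewrite ?phi_next// gK nth0 [in RHS](tuple_eta y).
have tnth_u y (i : 'I_n.+1) : phi (u y i) = tnth y i.
  by rewrite phi_u -tnth_nth.
exists (fun y => [tuple u y i | i < n.+1]) => [y|y Gy i j ij].
  by apply: eq_from_tnth => i; rewrite tnth_map tnth_mktuple tnth_u.
rewrite !tnth_mktuple ij /=; apply: F_next.
by rewrite tnth_u -ij -tnth_nth; exact: Gy.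
Qed.

Section entropy_bounds.
Context (R : realType).
Implicit Types X Y : metricType R.
Local Open Scope ereal_scope.

Lemma max_separated_semi_conjugate X Y (F : X -> set X) (G : Y -> set Y)
    (phi : X -> Y) (n : nat) (eps delta : R) : (0 < eps)%R ->
  set_surj [set: X] [set: Y] phi ->
  (forall x, G (phi x) `<=` phi @` F x) ->
  (forall x z, mdist x z < delta -> mdist (phi x) (phi z) < eps)%R ->
  max_separated G n eps <= max_separated F n delta.
Proof.
move=> eps0 sphi GF phi_unif; have [l lK lF] := orbit_lift n sphi GF.
apply: ereal_sup_le => _ [k [A [AG sA Ak]] <-]; exists k => //.
exists (l @` A); split.
- by move=> _ [y Ay <-]; exact/lF/AG.
- move=> _ _ [y Ay <-] [z Az <-] lyz.
  have yz : y <> z by move=> yz; apply: lyz; rewrite yz.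
  have := sA y z Ay Az yz; rewrite !leNgt; apply: contra => lyz_close.
  apply: bigmax_lt => // i _.
  rewrite -[y]lK -[z]lK !tnth_map; apply: phi_unif.
  by apply: le_lt_trans lyz_close; exact: (le_bigmax _ _ i).
- apply: card_eq_trans Ak; apply: inj_card_eq => y z _ _.
  exact: (can_inj lK).
Qed.

Lemma growth_le X Y (F : X -> set X) (G : Y -> set Y) (eps delta : R) :
  (forall n, max_separated G n eps <= max_separated F n delta) ->
  growth G eps <= growth F delta.
Proof.
move=> GF; rewrite /growth /limn_esup !limf_esupE.
apply: le_ereal_inf_tmp => _ [V VF <-].
apply: ge_ereal_inf; eexists; first by exists V; [exact: VF|reflexivity].
apply: ge_ereal_sup => _ [n Vn <-].
apply: le_trans; last first.
  by apply: ereal_sup_ubound; exists n; [exact: Vn|reflexivity].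
apply: lee_wpmul2l; first by rewrite lee_fin invr_ge0.
by rewrite lee_lne// in_itv/= leey max_separated_ge0.
Qed.

Lemma growth_le_entropy X (F : X -> set X) (delta : R) : (0 < delta)%R ->
  growth F delta <= entropy F.
Proof.
move=> delta0; apply: lime_ge; first exact: is_cvg_growth.
near=> e; apply: growth_nonincreasing; near: e; exact: nbhs_right_le.
Unshelve. all: by end_near. Qed.

End entropy_bounds.

Theorem theorem4p2 (R : realType) (X Y : metricType R)
    (F : X -> set X) (G : Y -> set Y)
    (compactX : compact [set: X]%classic) (compactY : compact [set: Y]%classic)
    (hF : forall x, hyperspace (F x)) (hG : forall y, hyperspace (G y))
    (uscF : upper_semicontinuous F) (uscG : upper_semicontinuous G)
    (GF : semi_conjugate G F) :
  (entropy G <= entropy F)%E.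
Proof.
have [phi [cphi sphi GphiF]] := GF.
apply: lime_le; first exact: is_cvg_growth.
near=> eps; have eps0 : 0 < eps by near: eps; exact: nbhs_right_gt.
have /unif_continuousP/(_ eps eps0)[delta delta0 phi_delta] :=
  compact_unif_continuous compactX cphi.
apply: le_trans (growth_le_entropy F delta0); apply: growth_le => n.
apply: (max_separated_semi_conjugate n eps0 sphi GphiF) => x z.
by have := phi_delta (x, z); rewrite !ballEmdist.
Unshelve. all: by end_near. Qed.
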